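(* Let $\alpha\in(0,1)$ and let $V_1,\dots,V_M$ be a weakly coupled directed chain partition of a network $G$ of $N$ firms $f_1,\dots,f_N$ with input-output matrix $W$ and coupling constant $\gamma$. Let $k\ge 0$ be an integer with $k+1\le M$, let $0\le\delta_k<1$, and let $U$ be an observed input-output matrix for $G$ such that for each firm in $V_1\cup\dots\cup V_{k+1}$ the missing data accounts for at most a $\delta_k$ share of its intermediate input use. Then, for any $f_i\in V_1$, $$|\langle e_i,v_W\rangle-\langle e_i,v_U\rangle|\le\frac{(1-\alpha)(2\delta_k-\delta_k^2)}{\alpha(1-\delta_k)}+2e^{-\log(1/\gamma)k},$$ where $e_i$ is the $i$-th standard basis vector of $\mathbb R^N$ (and $e^{-\log(1/\gamma)k}$ means $\gamma^k$).
   Context: An input-output matrix for firms $f_1,\dots,f_N$ is a real $N\times N$ matrix $W=(w_{ij})$ with $w_{ij}\ge0$, $w_{ii}=0$ and $\sum_jw_{ij}=1$ for all $i$; $w_{ij}$ is the share of the intermediate inputs of firm $f_i$ that come from firm $f_j$. With $W'$ the transpose and $\vec{\mathbf 1}$ the all-ones vector, the influence vector is $v_W=\frac{\alpha}{N}(I-(1-\alpha)W')^{-1}\vec{\mathbf 1}$ (the inverse exists). Missing data: firm $f_i$ has total intermediate input use $\mathrm{II}_i>0$, of which $w_{ij}\mathrm{II}_i$ comes from firm $f_j$. Only amounts $x_{ij}$ with $0\le x_{ij}\le w_{ij}\mathrm{II}_i$ and $\sum_kx_{ik}>0$ are observed; the rest is missing. The observed matrix is $U=(u_{ij})$ with $u_{ij}=x_{ij}/\sum_kx_{ik}$.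 ''The missing data accounts for at most a $\delta$ share of the intermediate input use of firm $f_i$'' means $\sum_jx_{ij}\ge(1-\delta)\mathrm{II}_i$. A partition of $V=\{f_1,\dots,f_N\}$ into nonempty disjoint sets $V_1,\dots,V_M$ is a directed chain for $W$ if firms interact only within the same part or between consecutive parts, and all interactions between $V_i$ and $V_{i+1}$ are directed from $V_i$ to $V_{i+1}$, in the sense that $W=\bigoplus_{i=1}^MW_i+\sum_{i=1}^{M-1}W_{\mathrm{int}}^{(i,i+1)}$ where $W_i$ is the block of $W$ with rows and columns in $V_i$, and, with respect to the ordering $V_i,V_{i+1}$, $$(W_{\mathrm{int}}^{(i,i+1)})'=\begin{bmatrix}0&A_1^{(i,i+1)}\\0&0\end{bmatrix}.$$ Equivalently: $w_{ab}\ne0$ only if $f_a,f_b$ lie in the same part, or $f_a\in V_{i+1}$ and $f_b\in V_i$ for some $i$; and $A_1^{(i,i+1)}$ is the $|V_i|\times|V_{i+1}|$ matrix whose $(f_b,f_a)$ entry is $w_{ab}$ for $f_b\in V_i$, $f_a\in V_{i+1}$. Let $m_i=|V_i|$. The coupling constant is $\gamma=(1-\alpha)\max_{1\le i\le M-1}\left\|(I_{m_i}-(1-\alpha)W_i')^{-1}A_1^{(i,i+1)}\right\|$ (spectral norm), and the chain is weakly coupled if $\gamma<1$. *)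

(* Defs.v *)
From mathcomp Require Import all_boot all_order all_algebra.
From mathcomp Require Import classical_sets reals.

Set Implicit Arguments.
Unset Strict Implicit.
Unset Printing Implicit Defensive.

Import Order.TTheory GRing.Theory Num.Theory.
Local Open Scope ring_scope.

Definition inner_prod (R : realType) (n : nat) (u v : 'cV[R]_n) : R :=
  \sum_i u i 0 * v i 0.

Definition euclid_norm (R : realType) (n : nat) (u : 'cV[R]_n) : R :=
  Num.sqrt (inner_prod u u).

(* The operator norm induced by the Euclidean norms. *)
Definition spectral_norm (R : realType) (m n : nat) (A : 'M[R]_(m, n)) : R :=
  sup (image [set x : 'cV[R]_n | euclid_norm x <= 1]%classic
             (fun x => euclid_norm (A *m x))).

Definition io_matrix (R : realType) (N : nat) (W : 'M[R]_N) : Prop :=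
  [/\ forall i j, 0 <= W i j, forall i, W i i = 0 &
      forall i, \sum_j W i j = 1].

Definition influence (R : realType) (N : nat) (alpha : R) (W : 'M[R]_N) :
    'cV[R]_N :=
  (alpha / N%:R) *: (invmx (1%:M - (1 - alpha) *: W^T) *m const_mx 1).

(* [input i] is the total intermediate input use of firm [i], and [X i j] the
   amount of it that is observed to come from firm [j]. *)
Definition observed_inputs (R : realType) (N : nat) (W : 'M[R]_N)
    (input : 'I_N -> R) (X : 'M[R]_N) : Prop :=
  [/\ forall i, 0 < input i,
      forall i j, 0 <= X i j <= W i j * input i &
      forall i, 0 < \sum_j X i j].

Definition observed_matrix (R : realType) (N : nat) (X : 'M[R]_N) : 'M[R]_N :=
  \matrix_(i, j) (X i j / \sum_l X i l).

Definition missing_share_le (R : realType) (N : nat) (input : 'I_N -> R)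
    (X : 'M[R]_N) (delta : R) (i : 'I_N) : Prop :=
  (1 - delta) * input i <= \sum_j X i j.

(* A family V_1, ..., V_M is given by V : nat -> {set 'I_N}; only the values
   V i with 1 <= i <= M are ever used. *)
Definition is_partition (N M : nat) (V : nat -> {set 'I_N}) : Prop :=
  [/\ forall i, (1 <= i <= M)%N -> V i != finset.set0,
      forall i j, (1 <= i <= M)%N -> (1 <= j <= M)%N -> i != j ->
        [disjoint V i & V j] &
      \bigcup_(1 <= i < M.+1) V i = [set: 'I_N]]%SET.

(* The N x N matrix that agrees with W on rows in A and columns in B, and
   vanishes elsewhere. *)
Definition restrict_mx (R : realType) (N : nat) (W : 'M[R]_N)
    (A B : {set 'I_N}) : 'M[R]_N :=
  \matrix_(a, b) (if (a \in A) && (b \in B) then W a b else 0).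

Definition directed_chain (R : realType) (N M : nat) (W : 'M[R]_N)
    (V : nat -> {set 'I_N}) : Prop :=
  is_partition M V /\
  W = \sum_(1 <= i < M.+1) restrict_mx W (V i) (V i)
      + \sum_(1 <= i < M) restrict_mx W (V i.+1) (V i).

Definition block_mx_of (R : realType) (N : nat) (W : 'M[R]_N)
    (A B : {set 'I_N}) : 'M[R]_(#|A|, #|B|) :=
  mxsub (@enum_val _ (mem A)) (@enum_val _ (mem B)) W.

(* The blocks W_i and A_1^(i,i+1); the latter is the nonzero block of the
   transpose of the interaction matrix, so that its (b, a) entry, for b in V_i
   and a in V_(i+1), is W a b. *)
Definition part_block (R : realType) (N : nat) (W : 'M[R]_N)
    (V : nat -> {set 'I_N}) (i : nat) : 'M[R]_#|V i| :=
  block_mx_of W (V i) (V i).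

Definition link_block (R : realType) (N : nat) (W : 'M[R]_N)
    (V : nat -> {set 'I_N}) (i : nat) : 'M[R]_(#|V i|, #|V i.+1|) :=
  (block_mx_of W (V i.+1) (V i))^T.

(* Norms being nonnegative, the base value 0 only matters when M = 1, in which
   case the coupling constant is 0. *)
Definition coupling (R : realType) (N M : nat) (alpha : R) (W : 'M[R]_N)
    (V : nat -> {set 'I_N}) : R :=
  (1 - alpha) *
  \big[Num.max/0]_(1 <= i < M)
    spectral_norm (invmx (1%:M - (1 - alpha) *: (part_block W V i)^T)
                   *m link_block W V i).

Definition weakly_coupled (R : realType) (N M : nat) (alpha : R) (W : 'M[R]_N)
    (V : nat -> {set 'I_N}) : Prop :=
  coupling M alpha W V < 1.

Lemma directed_chainP (R : realType) (N M : nat) (W : 'M[R]_N)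
    (V : nat -> {set 'I_N}) : is_partition M V ->
  directed_chain M W V <->
  (forall a b, W a b != 0 ->
     (exists i, [/\ (1 <= i <= M)%N, a \in V i & b \in V i]) \/
     (exists i, [/\ (1 <= i < M)%N, a \in V i.+1 & b \in V i])).
Proof.
move=> pV; have [_ dV cV] := pV.
have uV i j a : (1 <= i <= M)%N -> (1 <= j <= M)%N -> a \in V i -> a \in V j ->
    i = j.
  move=> hi hj ai aj; apply/eqP; apply: contraT => nij.
  by have /disjointFr/(_ ai) := dV i j hi hj nij; rewrite aj.
have exV a : exists2 i, (1 <= i <= M)%N & a \in V i.
  have : a \in (\bigcup_(1 <= i < M.+1) V i)%SET by rewrite cV inE.
  rewrite -(@big_map _ _ _ _ _ V (index_iota 1 M.+1) xpredT id).
  rewrite big_tnth => /bigcupP[j _].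
  set s := map V _ => aj; have : tnth (in_tuple s) j \in s by exact: mem_tnth.
  case/mapP=> i; rewrite mem_index_iota => hi e.
  by exists i => //; rewrite -e.
have sE a b i j (hi : (1 <= i <= M)%N) (hj : (1 <= j <= M)%N) (ai : a \in V i)
    (bj : b \in V j) :
    (\sum_(1 <= l < M.+1) restrict_mx W (V l) (V l)
      + \sum_(1 <= l < M) restrict_mx W (V l.+1) (V l)) a b =
    if (i == j) || (i == j.+1) then W a b else 0.
  rewrite mxE !summxE.
  have -> : \sum_(1 <= l < M.+1) restrict_mx W (V l) (V l) a b =
      if i == j then W a b else 0.
    have [eij|nij] := eqVneq i j.
      rewrite (big_rem i) /=; last by rewrite mem_index_iota ltnS.
      rewrite mxE ai eij bj /= big1_seq ?addr0 // => l /andP[_].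
      rewrite mem_rem_uniq ?iota_uniq // inE mem_index_iota ltnS => /andP[nl hl].
      rewrite mxE; case: ifP => // /andP[al _].
      have e : l = i by apply: (uV _ _ a).
      by rewrite e eij eqxx in nl.
    rewrite big1_seq // => l /andP[_]; rewrite mem_index_iota ltnS => hl.
    rewrite mxE; case: ifP => // /andP[al bl].
    have e : i = j by rewrite (uV i l a) // (uV l j b).
    by rewrite e eqxx in nij.
  have [eij|nij] := eqVneq i j.
    rewrite /= big1_seq ?addr0 // => l /andP[_].
    rewrite mem_index_iota => /andP[l1 lM].
    rewrite mxE; case: ifP => // /andP[al bl].
    have e1 : i = l.+1 by apply: (uV _ _ a).
    have e2 : j = l by apply: (uV _ _ b) => //; rewrite l1 ltnW.
    by move: eij; rewrite e1 e2 => /eqP; rewrite gtn_eqF.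
  rewrite add0r /=; have [eij|nij'] := eqVneq i j.+1.
    have jM : (1 <= j < M)%N by case/andP: hj hi => -> _; rewrite eij.
    rewrite (big_rem j) /=; last by rewrite mem_index_iota.
    rewrite mxE -eij ai bj /= big1_seq ?addr0 // => l /andP[_].
    rewrite mem_rem_uniq ?iota_uniq // inE mem_index_iota => /andP[nl].
    case/andP=> l1 lM; rewrite mxE; case: ifP => // /andP[_ bl].
    have e : l = j by apply: (uV _ _ b) => //; rewrite l1 ltnW.
    by rewrite e eqxx in nl.
  rewrite big1_seq // => l /andP[_]; rewrite mem_index_iota => /andP[l1 lM].
  rewrite mxE; case: ifP => // /andP[al bl].
  have e1 : i = l.+1 by apply: (uV _ _ a).
  have e2 : j = l by apply: (uV _ _ b) => //; rewrite l1 ltnW.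
  by rewrite e1 e2 eqxx in nij'.
split=> [[_ WE] a b|h].
  have [[i hi ai] [j hj bj]] := (exV a, exV b).
  rewrite {1}WE (sE a b i j) //; case: ifP => [|_]; last by rewrite eqxx.
  case/orP=> /eqP e _; first by left; exists i; split=> //; rewrite e.
  right; exists j; rewrite -e; split=> //.
  by case/andP: hi hj; rewrite e => _ ->; case/andP=> ->.
split=> //; apply/matrixP=> a b; have [[i hi ai] [j hj bj]] := (exV a, exV b).
rewrite (sE a b i j) //; case: ifP => // nij; apply/eqP.
apply: contraFT nij => /h[[l [hl al bl]]|[l [/andP[l1 lM] al bl]]].
  have e : i = j by rewrite (uV i l a) // (uV l j b).
  by rewrite e eqxx.
have -> : i = l.+1 by apply: (uV _ _ a).
have -> : j = l by apply: (uV _ _ b) => //; rewrite l1 ltnW.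
by rewrite eqxx orbT.
Qed.

(* Main.v *)
(* Put b = 1 - alpha, v = v_W, u = v_U. Subtracting the fixed point equations
   of v and u, d = v - u satisfies d = r + b W' d with r = b (W' - U') u. Let s
   solve s = r0 + b W' s, where r0 keeps the entries of r in V_1, ..., V_k.
   These entries only involve the rows of W - U in V_1, ..., V_(k+1), whose l1
   norms are at most 2 delta because (1 - delta) U <= W there. As u has l1 norm
   at most 1, s has l1 norm at most 2 b delta / alpha, which is below the first
   term of the bound. The difference e = d - s solves the homogeneous equation
   e = b W' e on V_1, ..., V_k, so each link of the chain contributes a factor
   gamma: |e on V_1| <= gamma^k |e on V_(k+1)|. Finally s vanishes on V_(k+1), so
   that e = d there, and d has l1 norm at most 2. *)
Require Import Defs.
From mathcomp Require Import all_boot all_order all_algebra.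
From mathcomp Require Import classical_sets reals.
From mathcomp Require Import ring lra.
Set Implicit Arguments.
Unset Strict Implicit.
Unset Printing Implicit Defensive.

Import Order.TTheory GRing.Theory Num.Theory.
Local Open Scope ring_scope.

(** * Euclidean and spectral norms *)

Lemma inner_prod_delta (R : realType) (n : nat) (i : 'I_n) (v : 'cV[R]_n) :
  inner_prod (delta_mx i 0) v = v i 0.
Proof.
rewrite /inner_prod (bigD1 i) //= big1 => [|j /negPf ji].
  by rewrite mxE !eqxx mul1r addr0.
by rewrite mxE ji mul0r.
Qed.

Lemma euclid_norm_ge_entry (R : realType) (n : nat) (u : 'cV[R]_n) (i : 'I_n) :
  `|u i 0| <= euclid_norm u.
Proof.
rewrite -sqrtr_sqr ler_wsqrtr // /inner_prod (bigD1 i) //= expr2 lerDl.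
by apply: sumr_ge0 => j _; rewrite -expr2 sqr_ge0.
Qed.

Lemma euclid_norm_le_sum (R : realType) (n : nat) (u : 'cV[R]_n) :
  euclid_norm u <= \sum_i `|u i 0|.
Proof.
have s0 : 0 <= \sum_i `|u i 0| by apply: sumr_ge0.
rewrite -(ger0_norm s0) -sqrtr_sqr ler_wsqrtr // expr2 mulr_suml.
apply: ler_sum => i _; rewrite -expr2 -real_normK ?num_real // expr2.
by rewrite ler_wpM2l // (bigD1 i) //= lerDl sumr_ge0.
Qed.

Lemma euclid_normZ (R : realType) (n : nat) (c : R) (u : 'cV[R]_n) :
  euclid_norm (c *: u) = `|c| * euclid_norm u.
Proof.
rewrite /euclid_norm -sqrtr_sqr -sqrtrM ?sqr_ge0 //; congr Num.sqrt.
rewrite /inner_prod mulr_sumr; apply: eq_bigr => i _.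
by rewrite !mxE; ring.
Qed.

Lemma euclid_norm_mulmx (R : realType) (m n : nat) (A : 'M[R]_(m, n))
    (x : 'cV[R]_n) :
  euclid_norm (A *m x) <= spectral_norm A * euclid_norm x.
Proof.
have ub y : euclid_norm y <= 1 -> euclid_norm (A *m y) <= spectral_norm A.
  move=> y1; apply: ub_le_sup; last by exists y.
  (* The sum of the absolute values of all entries of [A] bounds the image of the unit ball, so the
     supremum is a genuine least upper bound. *)
  exists (\sum_i \sum_j `|A i j|) => _ [z z1 <-].
  apply: le_trans (euclid_norm_le_sum _) _; apply: ler_sum => i _.
  rewrite mxE; apply: le_trans (ler_norm_sum _ _ _) _; apply: ler_sum => j _.
  rewrite normrM ler_piMr //; exact: le_trans (euclid_norm_ge_entry _ _) z1.
have [x0|xn0] := eqVneq (euclid_norm x) 0.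
  have -> : x = 0.
    apply/colP=> i; apply/eqP; rewrite mxE -normr_le0.
    by apply: le_trans (euclid_norm_ge_entry x i) _; rewrite x0.
  rewrite mulmx0 -[X in euclid_norm X <= _](scale0r 0) euclid_normZ.
  by rewrite normr0 mul0r -(scale0r 0) euclid_normZ normr0 mul0r mulr0.
have xp : 0 < euclid_norm x by rewrite lt_def xn0 sqrtr_ge0.
have [y -> y1] : exists2 y, x = euclid_norm x *: y & euclid_norm y = 1.
  exists ((euclid_norm x)^-1 *: x); first by rewrite scalerA divff // scale1r.
  by rewrite euclid_normZ normfV gtr0_norm // mulVf.
rewrite -scalemxAr !euclid_normZ y1 mulr1 mulrC.
by rewrite ler_wpM2r ?normr_ge0 // ub // y1.
Qed.

(** * Resolvents of substochastic matrices and influence vectors *)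

(* The transpose of a substochastic matrix does not increase the l1 norm, even
   when only the entries with both indices in [T] are kept. *)
Lemma l1_resolvent_bound (R : realType) (n : nat) (A : 'M[R]_n) (b : R)
    (T : pred 'I_n) (c x : 'I_n -> R) : 0 <= b ->
    (forall i j, 0 <= A i j) -> (forall i, \sum_j A i j <= 1) ->
    (forall i, T i -> `|x i| <= c i + b * \sum_(j | T j) A j i * `|x j|) ->
  (1 - b) * \sum_(i | T i) `|x i| <= \sum_(i | T i) c i.
Proof.
move=> b0 A0 A1 hx.
have : \sum_(i | T i) `|x i| <=
    \sum_(i | T i) c i + b * \sum_(j | T j) `|x j|.
  apply: le_trans (ler_sum _ hx) _; rewrite big_split lerD2l -mulr_sumr.
  rewrite ler_wpM2l // exchange_big; apply: ler_sum => j _ /=.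
  rewrite -mulr_suml ler_piMl //; apply: le_trans (A1 j).
  by rewrite [leRHS](bigID T) /= lerDl sumr_ge0.
by rewrite mulrBl mul1r lerBlDr.
Qed.

(** A kernel vector satisfies the inequality of [l1_resolvent_bound] with [c = 0], so its l1 norm
    vanishes because [1 - b > 0]. *)
Lemma substochastic_unitmx (R : realType) (n : nat) (A : 'M[R]_n) (b : R) :
    0 <= b < 1 -> (forall i j, 0 <= A i j) -> (forall i, \sum_j A i j <= 1) ->
  1%:M - b *: A^T \in unitmx.
Proof.
move=> /andP[b0 b1] A0 A1.
rewrite -unitmx_tr -row_free_unit; apply: inj_row_free => v.
rewrite linearB /= trmx1 linearZ /= trmxK mulmxBr mulmx1 -scalemxAr.
move/subr0_eq => vE.
have vP i : xpredT i -> `|v 0 i| <= 0 + b * \sum_j A j i * `|v 0 j|.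
  rewrite {1}vE !mxE normrM (ger0_norm b0) add0r => _; rewrite ler_wpM2l //.
  apply: le_trans (ler_norm_sum _ _ _) _; apply: ler_sum => j _.
  by rewrite normrM (ger0_norm (A0 _ _)) mulrC.
have := @l1_resolvent_bound R n A b xpredT (fun=> 0) (v 0) b0 A0 A1 vP.
rewrite [leRHS]big1 // pmulr_rle0 ?subr_gt0 // => s0.
apply/rowP=> i; apply/eqP; rewrite mxE -normr_le0; apply: le_trans s0.
by rewrite (bigD1 i) //= lerDl sumr_ge0.
Qed.

Lemma resolventE (R : realType) (n : nat) (A : 'M[R]_n) (b : R)
    (c : 'cV[R]_n) (i : 'I_n) : 1%:M - b *: A^T \in unitmx ->
  let x := invmx (1%:M - b *: A^T) *m c in
  x i 0 = c i 0 + b * \sum_j A j i * x j 0.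
Proof.
move=> Au x; have xE : (1%:M - b *: A^T) *m x = c by rewrite /x mulKVmx.
clearbody x; rewrite -xE mulmxBl mul1mx -scalemxAl !mxE.
by under eq_bigr do rewrite mxE; rewrite subrK.
Qed.

Lemma influenceE (R : realType) (n : nat) (A : 'M[R]_n) (alpha : R)
    (i : 'I_n) : 0 < alpha < 1 ->
    (forall i j, 0 <= A i j) -> (forall i, \sum_j A i j <= 1) ->
  influence alpha A i 0 =
    alpha / n%:R + (1 - alpha) * \sum_j A j i * influence alpha A j 0.
Proof.
move=> ha A0 A1; rewrite /influence scalemxAr resolventE.
  by rewrite !mxE mulr1.
by apply: substochastic_unitmx => //; lra.
Qed.

(** The constant terms [alpha / n] sum to at most [alpha], which cancels the factor
    [1 - (1 - alpha)] of [l1_resolvent_bound]. *)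
Lemma influence_l1_le1 (R : realType) (n : nat) (A : 'M[R]_n) (alpha : R) :
    0 < alpha < 1 ->
    (forall i j, 0 <= A i j) -> (forall i, \sum_j A i j <= 1) ->
  \sum_i `|influence alpha A i 0| <= 1.
Proof.
move=> ha A0 A1; have /andP[a0 a1] := ha.
have b0 : 0 <= 1 - alpha by lra.
have vP i : xpredT i -> `|influence alpha A i 0| <=
    alpha / n%:R + (1 - alpha) * \sum_j A j i * `|influence alpha A j 0|.
  rewrite {1}influenceE // => _; apply: le_trans (ler_normD _ _) _.
  have c0 : 0 <= alpha / n%:R by rewrite divr_ge0 ?ler0n // ltW.
  rewrite (ger0_norm c0) lerD2l normrM (ger0_norm b0) ler_wpM2l //.
  apply: le_trans (ler_norm_sum _ _ _) _; apply: ler_sum => j _.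
  by rewrite normrM (ger0_norm (A0 _ _)).
have := @l1_resolvent_bound R n A (1 - alpha) xpredT (fun=> alpha / n%:R)
  (fun i => influence alpha A i 0) b0 A0 A1 vP.
rewrite subKr => h; rewrite -(ler_pM2l a0) mulr1; apply: le_trans h _.
rewrite sumr_const card_ord -[leLHS]mulr_natr.
(* For [n = 0] the quotient has no meaning, but it is multiplied by [0]. *)
have [->|n0] := eqVneq n 0%N; first by rewrite mulr0 ltW.
by rewrite mulfVK // pnatr_eq0.
Qed.

(** * Levels of the chain, and rows of the observed matrix *)

(** The parts cover and are disjoint, so each firm has a unique level [f a]; the chain condition
    becomes arithmetic on levels. *)
Lemma directed_chain_level (R : realType) (N M : nat) (W : 'M[R]_N)
    (V : nat -> {set 'I_N}) : directed_chain M W V ->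
  exists f : 'I_N -> nat, [/\ forall a, (1 <= f a <= M)%N,
    forall p a, (1 <= p <= M)%N -> (a \in V p) = (f a == p) &
    forall a b, W a b != 0 -> (f a == f b) || (f a == (f b).+1)].
Proof.
move=> cW; have [pV _] := cW; have [_ dV cV] := pV.
have exV (a : 'I_N) : exists p, (1 <= p <= M)%N /\ a \in V p.
  have : a \in (\bigcup_(1 <= i < M.+1) V i)%SET by rewrite cV inE.
  rewrite big_seq; elim/big_ind: _ => [|A B hA hB|p].
  - by rewrite inE.
  - by rewrite inE => /orP[/hA|/hB].
  - by rewrite mem_index_iota ltnS; exists p.
have [f hf] := fin_all_exists exV.
have fV p a : (1 <= p <= M)%N -> (a \in V p) = (f a == p).
  move=> hp; have [hfa afa] := hf a; apply/idP/eqP => [ap|<- //].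
  apply/eqP; apply: contraT => nfp.
  by have /disjointFr/(_ afa) := dV _ _ hfa hp nfp; rewrite ap.
exists f; split=> // [a|a b]; first by case: (hf a).
case/(directed_chainP W pV).1 => // -[p [/andP[p1 pM]]].
  by rewrite !fV ?p1 // => /eqP-> /eqP->; rewrite eqxx.
by rewrite !fV ?p1 // 1?ltnW // => /eqP-> /eqP->; rewrite eqxx orbT.
Qed.

(** Since [X i j] is at most [W i j * input i] and the observed total is at least
    [(1 - delta) * input i], [(1 - delta) * U <= W] on row [i]. Hence [|W - U| <= (W - U + delta *
    U) + delta * U], and both rows sum to 1. *)
Lemma observed_row_diff (R : realType) (N : nat) (W : 'M[R]_N)
    (input : 'I_N -> R) (X : 'M[R]_N) (delta : R) (i : 'I_N) :
    (forall i, \sum_j W i j = 1) -> observed_inputs W input X ->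
    0 <= delta < 1 -> missing_share_le input X delta i ->
  \sum_j `|W i j - observed_matrix X i j| <= 2 * delta.
Proof.
move=> W1 [I0 XW X0] /andP[d0 d1] hd.
have U1 : \sum_j observed_matrix X i j = 1.
  under eq_bigr do rewrite mxE.
  by rewrite -mulr_suml divff // gt_eqF.
have step j : `|W i j - observed_matrix X i j| <=
    W i j - observed_matrix X i j + 2 * delta * observed_matrix X i j.
  have /andP[x0 xw] := XW i j; have I0i := I0 i; have S0 := X0 i.
  rewrite mxE; set u := X i j / _.
  have u0 : 0 <= u by rewrite divr_ge0 // ltW.
  have xE : X i j = u * \sum_l X i l by rewrite mulfVK // gt_eqF.
  have uW : (1 - delta) * u <= W i j.
    rewrite -(ler_pM2r I0i); apply: le_trans xw; rewrite xE.
    by rewrite mulrAC mulrC ler_wpM2l.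
  have du : 0 <= delta * u by rewrite mulr_ge0.
  by rewrite ler_norml; apply/andP; split; lra.
apply: le_trans (ler_sum _ (fun j _ => step j)) _.
by rewrite big_split sumrB /= -mulr_sumr W1 U1; lra.
Qed.

(** * Decay along the chain *)

(** The coordinates are enumerated as in [block_mx_of], so that the blocks of [W] act on these
    vectors. *)
Definition part_vector (R : realType) (N : nat) (A : {set 'I_N})
    (e : 'cV[R]_N) : 'cV[R]_#|A| :=
  rowsub (@enum_val _ (mem A)) e.

Lemma part_vector_norm_le (R : realType) (N : nat) (A : {set 'I_N})
    (e : 'cV[R]_N) :
  euclid_norm (part_vector A e) <= \sum_(a in A) `|e a 0|.
Proof.
apply: le_trans (euclid_norm_le_sum _) _.
by rewrite (big_enum_val (fun a => `|e a 0|)); under eq_bigr do rewrite mxE.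
Qed.

Lemma part_vector_norm_ge (R : realType) (N : nat) (A : {set 'I_N})
    (e : 'cV[R]_N) (a : 'I_N) : a \in A ->
  `|e a 0| <= euclid_norm (part_vector A e).
Proof.
move=> aA; have := euclid_norm_ge_entry (part_vector A e) (enum_rank_in aA a).
by rewrite mxE enum_rankK_in.
Qed.

Lemma coupling_ge0 (R : realType) (N M : nat) (alpha : R) (W : 'M[R]_N)
    (V : nat -> {set 'I_N}) : 0 < alpha < 1 -> 0 <= coupling M alpha W V.
Proof.
move=> /andP[_ a1]; rewrite mulr_ge0 ?subr_ge0 ?(ltW a1) //.
exact: Order.TotalTheory.bigmax_ge_id.
Qed.

(** Columns of [W] in [V p] are supported on rows in [V p] and [V p.+1]. Moving the [V p] terms to
    the left and inverting writes the part of [e] on [V p] as a matrix from the maximum defining the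
    coupling constant, times [1 - alpha], applied to its part on [V p.+1]. *)
Lemma chain_step (R : realType) (N M : nat) (alpha : R) (W : 'M[R]_N)
    (V : nat -> {set 'I_N}) (p : nat) (e : 'cV[R]_N) :
    0 < alpha < 1 -> io_matrix W -> directed_chain M W V -> (1 <= p < M)%N ->
    (forall a, a \in V p -> e a 0 = (1 - alpha) * \sum_j W j a * e j 0) ->
  euclid_norm (part_vector (V p) e) <=
    coupling M alpha W V * euclid_norm (part_vector (V p.+1) e).
Proof.
move=> ha [W0 _ W1] cW /andP[p1 pM] he; have /andP[a0 a1] := ha.
have [f [_ fV fW]] := directed_chain_level cW.
set B := part_block W V p; set L := link_block W V p.
set x := part_vector (V p) e; set y := part_vector (V p.+1) e.
have B0 i j : 0 <= B i j by rewrite mxE.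
have B1 i : \sum_j B i j <= 1.
  under eq_bigr do rewrite mxE.
  rewrite -(big_enum_val (fun b => W (enum_val i) b)) /= -(W1 (enum_val i)).
  by rewrite [leRHS](bigID (mem (V p))) /= lerDl sumr_ge0.
have Bu : 1%:M - (1 - alpha) *: B^T \in unitmx.
  by apply: substochastic_unitmx => //; lra.
have xE : (1%:M - (1 - alpha) *: B^T) *m x = (1 - alpha) *: (L *m y).
  rewrite mulmxBl mul1mx -scalemxAl; apply/eqP; rewrite subr_eq -scalerDr.
  apply/eqP/colP => i; rewrite !mxE; set a := enum_val i.
  have ap : a \in V p by exact: enum_valP.
  rewrite he //; congr (_ * _); rewrite addrC (bigID (mem (V p))) /=.
  congr (_ + _).
    rewrite (big_enum_val (fun j => W j a * e j 0)).
    by apply: eq_bigr => j _; rewrite !mxE.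
  transitivity (\sum_(j in V p.+1) W j a * e j 0); last first.
    rewrite (big_enum_val (fun j => W j a * e j 0)).
    by apply: eq_bigr => j _; rewrite !mxE.
  (* Termwise comparison: if [W j a] is nonzero, [j] has level [p] or [p.+1], so lying outside [V p]
     means lying in [V p.+1]. *)
  rewrite big_mkcond [RHS]big_mkcond; apply: eq_bigr => j _ /=.
  move: ap; rewrite !fV ?p1 ?(ltnW pM) // => /eqP fa.
  have [-> | /fW] := eqVneq (W j a) 0; first by rewrite mul0r !if_same.
  rewrite fa => /orP[]/eqP->; first by rewrite eqxx ltn_eqF.
  by rewrite eqxx gtn_eqF.
have -> : x = (1 - alpha) *: (invmx (1%:M - (1 - alpha) *: B^T) *m L *m y).
  by rewrite -mulmxA scalemxAr -xE mulKmx.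
have b0 : 0 <= 1 - alpha by lra.
rewrite euclid_normZ (ger0_norm b0) /coupling -[leRHS]mulrA.
rewrite (ler_wpM2l b0) //.
apply: le_trans (euclid_norm_mulmx _ _) _; rewrite ler_wpM2r ?sqrtr_ge0 //.
apply: (Order.TotalTheory.le_bigmax_seq _ p xpredT (fun i =>
  spectral_norm (invmx (1%:M - (1 - alpha) *: (part_block W V i)^T)
    *m link_block W V i))) => //.
by rewrite mem_index_iota p1.
Qed.

Lemma chain_decay (R : realType) (N M : nat) (alpha : R) (W : 'M[R]_N)
    (V : nat -> {set 'I_N}) (k : nat) (e : 'cV[R]_N) :
    0 < alpha < 1 -> io_matrix W -> directed_chain M W V -> (k < M)%N ->
    (forall p a, (1 <= p <= k)%N -> a \in V p ->
      e a 0 = (1 - alpha) * \sum_j W j a * e j 0) ->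
  euclid_norm (part_vector (V 1%N) e) <=
    coupling M alpha W V ^+ k * euclid_norm (part_vector (V k.+1) e).
Proof.
move=> ha hW cW; elim: k => [|k IHk] kM he; first by rewrite expr0 mul1r.
apply: le_trans (IHk (ltnW kM) _) _.
  move=> p a /andP[p1 pk]; apply: he; by rewrite p1 ltnW.
rewrite exprSr -mulrA ler_wpM2l ?exprn_ge0 ?coupling_ge0 //.
by apply: chain_step => // a; apply: he; rewrite ltnSn.
Qed.

(** * Comparison of the two influence vectors *)

Theorem corollary8p4 (R : realType) (alpha : R) (halpha : 0 < alpha < 1)
    (N M : nat) (W : 'M[R]_N) (hW : io_matrix W)
    (V : nat -> {set 'I_N}) (hV : directed_chain M W V)
    (hgamma : weakly_coupled M alpha W V)
    (k : nat) (hk : (k.+1 <= M)%N)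
    (delta : R) (hdelta : 0 <= delta < 1)
    (input : 'I_N -> R) (X : 'M[R]_N) (hX : observed_inputs W input X)
    (hmissing : forall p : nat, (1 <= p <= k.+1)%N ->
       forall i : 'I_N, i \in V p -> missing_share_le input X delta i)
    (i : 'I_N) (hi : i \in V 1%N) :
  `| inner_prod (delta_mx i 0) (influence alpha W)
     - inner_prod (delta_mx i 0) (influence alpha (observed_matrix X)) |
  <= (1 - alpha) * (2 * delta - delta ^+ 2) / (alpha * (1 - delta))
     + 2 * coupling M alpha W V ^+ k.
Proof.
have /andP[a0 a1] := halpha; have /andP[d0 d1] := hdelta.
have b0 : 0 <= 1 - alpha by lra.
have [W0 _ W1] := hW; have [I0 XW X0] := hX.
have W1' j : \sum_l W j l <= 1 by rewrite W1.
rewrite !inner_prod_delta; set U := observed_matrix X.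
have U0 j l : 0 <= U j l.
  by rewrite mxE divr_ge0 ?(ltW (X0 _)) //; case/andP: (XW j l).
have U1' j : \sum_l U j l <= 1.
  under eq_bigr do rewrite mxE.
  by rewrite -mulr_suml divff // gt_eqF.
have [f [f1 fV fW]] := directed_chain_level hV.
set v := influence alpha W; set u := influence alpha U.
(* [U] inherits the chain structure: [X], and so [U], vanishes wherever [W] does. *)
have fU j a : U j a != 0 -> (f j == f a) || (f j == (f a).+1).
  move=> Uja; apply: fW; apply: contraNneq Uja => W0ja.
  have := XW j a; rewrite W0ja mul0r -eq_le => /eqP X0ja; rewrite mxE -X0ja.
  by rewrite mul0r eqxx.
pose r : 'cV_N := \col_a
  if (f a <= k)%N then (1 - alpha) * \sum_j (W j a - U j a) * u j 0 else 0.
have u1 : \sum_j `|u j 0| <= 1 by exact: influence_l1_le1.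
have v1 : \sum_j `|v j 0| <= 1 by exact: influence_l1_le1.
have r1 : \sum_a `|r a 0| <= (1 - alpha) * (2 * delta).
  apply: (@le_trans _ _ ((1 - alpha) *
      \sum_a \sum_(j | (f j <= k.+1)%N) `|W j a - U j a| * `|u j 0|)).
    rewrite mulr_sumr; apply: ler_sum => a _; rewrite mxE.
    case: leqP => fak; last first.
      by rewrite normr0 mulr_ge0 // sumr_ge0 // => j _; rewrite mulr_ge0.
    rewrite normrM (ger0_norm b0) ler_wpM2l //.
    apply: le_trans (ler_norm_sum _ _ _) _.
    rewrite [leRHS]big_mkcond; apply: ler_sum => j _; rewrite normrM.
    case: leqP => // fj.
    (* With [f a <= k], a row of level above [k.+1] is too far from [a] to interact with it, in [W]
       or in [U]. *)
    have z (Z : 'M[R]_N) : (Z j a != 0 -> (f j == f a) || (f j == (f a).+1)) ->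
        Z j a = 0.
      move=> h; apply/eqP; apply: contraTT fj => /h.
      by rewrite -leqNgt => /orP[]/eqP->; rewrite ?ltnS // ltnW.
    by rewrite (z _ (fW j a)) (z _ (fU j a)) subrr normr0 mul0r.
  rewrite ler_wpM2l // exchange_big /=.
  apply: (@le_trans _ _ (\sum_(j | (f j <= k.+1)%N) 2 * delta * `|u j 0|)).
    apply: ler_sum => j fj; rewrite -mulr_suml ler_wpM2r //.
    apply: (observed_row_diff W1 hX hdelta); apply: (hmissing (f j)).
      by rewrite fj; case/andP: (f1 j) => ->.
    by rewrite fV.
  rewrite -mulr_sumr -[leRHS]mulr1 ler_wpM2l ?mulr_ge0 //.
  by apply: le_trans u1; rewrite [leRHS](bigID (fun j => f j <= k.+1)%N) /=
    lerDl sumr_ge0.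
have Wu : 1%:M - (1 - alpha) *: W^T \in unitmx.
  by apply: substochastic_unitmx => //; lra.
pose s : 'cV_N := invmx (1%:M - (1 - alpha) *: W^T) *m r.
have sE a : s a 0 = r a 0 + (1 - alpha) * \sum_j W j a * s j 0.
  exact: resolventE.
have s_le : \sum_a `|s a 0| <= (1 - alpha) * (2 * delta) / alpha.
  rewrite ler_pdivlMr // mulrC; apply: le_trans r1.
  have {1}-> : alpha = 1 - (1 - alpha) by lra.
  apply: (l1_resolvent_bound b0 W0 W1' (x := fun a => s a 0)) => a _.
  rewrite {1}sE; apply: le_trans (ler_normD _ _) _.
  rewrite lerD2l normrM (ger0_norm b0) ler_wpM2l //.
  apply: le_trans (ler_norm_sum _ _ _) _; apply: ler_sum => j _.
  by rewrite normrM (ger0_norm (W0 _ _)).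
(* The levels above [k] form a closed system: a nonzero [W j b] forces [f j >= f b]. As [r] vanishes
   there, [l1_resolvent_bound] with [c = 0] applies. *)
have s0 a : (k < f a)%N -> s a 0 = 0.
  move=> fa; apply/eqP; rewrite -normr_le0.
  apply: (@le_trans _ _ (\sum_(a | (k < f a)%N) `|s a 0|)).
    by rewrite (bigD1 a) //= lerDl sumr_ge0.
  rewrite -(pmulr_rle0 _ a0); have {1}-> : alpha = 1 - (1 - alpha) by lra.
  apply: (@le_trans _ _ (\sum_(b | (k < f b)%N) 0)); last by rewrite big1.
  apply: (l1_resolvent_bound b0 W0 W1' (x := fun a => s a 0)) => b fb.
  rewrite {1}sE mxE leqNgt fb add0r normrM (ger0_norm b0) add0r ler_wpM2l //.
  apply: le_trans (ler_norm_sum _ _ _) _.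
  rewrite [leRHS]big_mkcond; apply: ler_sum => j _.
  rewrite normrM (ger0_norm (W0 _ _)); case: ltnP => // fj.
  have [-> | /fW /orP[]/eqP h] := eqVneq (W j b) 0; first by rewrite mul0r.
    by move: fb; rewrite -h ltnNge fj.
  by move: (ltnW fb); rewrite -ltnS -h ltnNge (leq_trans fj).
pose e := v - u - s.
have eB a : e a 0 = v a 0 - u a 0 - s a 0.
  have mxB (x y : 'cV[R]_N) : (x - y) a 0 = x a 0 - y a 0 by rewrite !mxE.
  by rewrite !mxB.
(* On these levels [r] is not truncated, so it cancels the whole source term; the constants
   [alpha / N] cancel in [v - u]. *)
have eE p a : (1 <= p <= k)%N -> a \in V p ->
    e a 0 = (1 - alpha) * \sum_j W j a * e j 0.
  move=> /andP[p1 pk]; rewrite fV; last by rewrite p1 (leq_trans pk) // ltnW.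
  move=> /eqP fa; rewrite eB sE [r a 0]mxE fa pk.
  rewrite /v /u !influenceE // -/v -/u.
  have -> : \sum_j W j a * e j 0 = \sum_j W j a * v j 0 - \sum_j U j a * u j 0
      - \sum_j (W j a - U j a) * u j 0 - \sum_j W j a * s j 0.
    by rewrite -!sumrB; apply: eq_bigr => j _; rewrite eB; ring.
  by ring.
have e_le : euclid_norm (part_vector (V k.+1) e) <= 2.
  apply: le_trans (part_vector_norm_le _ _) _.
  apply: (@le_trans _ _ (\sum_a (`|v a 0| + `|u a 0|))); last first.
    by rewrite big_split /=; lra.
  rewrite big_mkcond; apply: ler_sum => a _; rewrite fV //.
  case: eqP => [fa|_]; last by rewrite addr_ge0.
  by rewrite eB s0 ?fa // subr0 ler_normB.
have -> : v i 0 - u i 0 = s i 0 + e i 0 by rewrite eB; ring.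
apply: le_trans (ler_normD _ _) _; apply: lerD; last first.
  apply: le_trans (part_vector_norm_ge _ hi) _.
  apply: le_trans (chain_decay halpha hW hV hk eE) _.
  by rewrite mulrC ler_wpM2r // exprn_ge0 // coupling_ge0.
apply: (@le_trans _ _ ((1 - alpha) * (2 * delta) / alpha)).
  by apply: le_trans s_le; rewrite (bigD1 i) //= lerDl sumr_ge0.
(* What remains is [2 * delta * (1 - delta) <= 2 * delta - delta ^+ 2], that is,
   [0 <= delta ^+ 2]. *)
rewrite invfM [leRHS]mulrA [leRHS]mulrAC ler_pM2r ?invr_gt0 // -[leRHS]mulrA.
rewrite ler_wpM2l // ler_pdivlMr ?subr_gt0 //.
by have := sqr_ge0 delta; lra.
Qed.
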